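(* Let $(V,E)$ be a simple Bratteli diagram (with infinite path space), let $h\colon \mathbb{N}^\star\to\mathbb{R}_+$ be a decreasing function satisfying $\lim_{i\to\infty}h(i)=0$ and $\lim_{i\to\infty} i\,h(i)=+\infty$, and let $f\colon\mathbb{N}^\star\to\mathbb{R}_+$ be any increasing function. Then there exists a simple Bratteli diagram $(V',E')$ with sequence of incidence matrices $(M'_i)_{i\in\mathbb{N}}$ such that: (i) $K_0(V,E)\cong K_0(V',E')$; (ii) for all $i\ge 1$, $u\in V'_{i-1}$ and $v\in V'_i$, $M'_{i-1}(v,u)\ge f(|V'_i|)$; (iii) for all $i\ge 1$, $\frac{\ell'_i}{L'_i}\ge 1-h(L'_i)$, where $L'_i$ and $\ell'_i$ denote respectively the maximal and minimal number of paths from the top vertex to the vertices of $V'_i$. In particular, $(V',E')$ is pseudo-ERS.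
   Context: $\mathbb{N}=\{0,1,2,\dots\}$, $\mathbb{N}^\star=\{1,2,\dots\}$. ''Increasing'' and ''decreasing'' are not required to be strict. A Bratteli diagram $(V,E)$ is an infinite directed graph (multiple edges allowed) with vertex set $V=\bigsqcup_{i\ge0}V_i$ and edge set $E=\bigsqcup_{i\ge1}E_i$, all $V_i,E_i$ finite and non-empty, $V_0$ a single point (the top vertex), with source and range maps $s,r\colon E\to V$ such that $s(E_i)\subseteq V_{i-1}$, $r(E_i)\subseteq V_i$, $s^{-1}(v)\ne\emptyset$ for all $v\in V$ and $r^{-1}(v)\neq\emptyset$ for all $v\in V\setminus V_0$. The incidence matrix $M_i$ ($i\ge 0$) is the $|V_{i+1}|\times|V_i|$ matrix whose entry $M_i(v,u)$ is the number of edges from $u\in V_i$ to $v\in V_{i+1}$. For a strictly increasing sequence $(t_i)_{i\ge0}$ of natural numbers with $t_0=0$, the telescoping of $(V,E)$ to $(t_i)$ is the Bratteli diagram with vertex sets $V_{t_i}$ and incidence matrices $M_{t_{i+1}-1}\cdots M_{t_i}$. A Bratteli diagram is simple if some telescoping of it has all incidence matrices with positive entries. Standing assumption: the set of infinite paths $(e_1,e_2,\dots)$, $e_i\in E_i$, $r(e_i)=s(e_{i+1})$, is infinite. The dimension group $K_0(V,E)$ is the ordered group with unit given by the inductive limit of $\mathbb{Z}^{|V_0|}\xrightarrow{M_0}\mathbb{Z}^{|V_1|}\xrightarrow{M_1}\cdots$ with the induced order and order unit the class of $1\in\mathbb{Z}^{|V_0|}$; $\cong$ means isomorphism of ordered groups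 with unit. A simple Bratteli diagram is pseudo-ERS if $\lim_{i\to\infty}L_i/\ell_i=1$, where $L_i$ and $\ell_i$ ($i\ge1$) are the maximal and minimal number of paths from the top vertex to vertices of $V_i$. *)

(* Defs.v *)
From HB Require Import structures.
From mathcomp Require Import all_boot all_order all_algebra.
From mathcomp Require Import generic_quotient.
From mathcomp Require Import all_classical all_reals all_analysis.

Set Implicit Arguments.
Unset Strict Implicit.
Unset Printing Implicit Defensive.

Import Order.TTheory GRing.Theory Num.Theory.
Import numFieldNormedType.Exports.

Local Open Scope ring_scope.

(* [edge i] is the edge set E_(i+1), which joins V_i to V_(i+1).  That all the
   V_i and E_i are non-empty follows from the last three fields. *)
Record bratteli := Bratteli {
  vertex : nat -> finType;
  edge : nat -> finType;
  src : forall i, edge i -> vertex i;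
  rng : forall i, edge i -> vertex i.+1;
  top_single : #|vertex 0| = 1%N;
  src_onto : forall i (u : vertex i), exists e : edge i, src e = u;
  rng_onto : forall i (v : vertex i.+1), exists e : edge i, rng e = v
}.

Section Bratteli.
Variable B : bratteli.
Local Notation V := (vertex B).
Local Notation E := (edge B).

Definition incidence i (v : V i.+1) (u : V i) : nat :=
  #|[set e : E i | (src e == u) && (rng e == v)]|.

(* The entry (v, u) of the matrix product M_(n-1) ... M_m: the identity matrix
   if m = n, and by convention the zero matrix if m > n.  Comparing vertices in
   the disjoint union of the V_i avoids transports along equalities of levels. *)
Fixpoint incprod m n : V n -> V m -> nat :=
  match n with
  | 0 => fun v u => Tagged V v == Tagged V u
  | n'.+1 => fun v u =>
      if (n' < m)%N then (Tagged V v == Tagged V u : nat)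
      else (\sum_(w : V n') incidence v w * incprod w u)%N
  end.

Lemma incprodS m n (v : V n.+1) (u : V m) : (m <= n)%N ->
  incprod v u = (\sum_(w : V n) incidence v w * incprod w u)%N.
Proof. by move=> le_mn /=; rewrite ltnNge le_mn. Qed.

Lemma incprod_id n (v u : V n) : incprod v u = (v == u).
Proof. by case: n v u => [|n] v u /=; rewrite ?ltnSn eq_Tagged. Qed.

Lemma incprod_comp m n p (v : V p) (u : V m) : (m <= n)%N -> (n <= p)%N ->
  incprod v u = (\sum_(w : V n) incprod v w * incprod w u)%N.
Proof.
move=> le_mn; elim: p v => [|p IHp] v.
  rewrite leqn0 => /eqP n0; subst n.
  rewrite (bigD1 v) //= big1 => [|w]; first by rewrite eqxx mul1n addn0.
  by rewrite eq_Tagged /= eq_sym => /negPf->.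
rewrite leq_eqVlt => /orP[/eqP eq_np|]; last first.
  rewrite ltnS => le_np; rewrite (incprodS _ _ (leq_trans le_mn le_np)).
  under [RHS]eq_bigr do rewrite (incprodS _ _ le_np) big_distrl.
  rewrite exchange_big /=; apply: eq_bigr => w _.
  by rewrite (IHp _ le_np) big_distrr; apply: eq_bigr => w' _ /=; rewrite mulnA.
subst n; rewrite [RHS](bigD1 v) // big1 => [|w w_v].
  by rewrite Monoid.mulm1 incprod_id eqxx mul1n.
by rewrite incprod_id eq_sym (negPf w_v).
Qed.

Lemma incidence_gt0 i (e : E i) : (0 < incidence (rng e) (src e))%N.
Proof. by apply/card_gt0P; exists e; rewrite inE !eqxx. Qed.

Lemma incprod_gt0_step m n (v : V n.+1) (w : V n) (u : V m) : (m <= n)%N ->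
  (0 < incidence v w)%N -> (0 < incprod w u)%N -> (0 < incprod v u)%N.
Proof.
move=> le_mn v_w w_u; rewrite incprodS // (bigD1 w) //=.
by rewrite addn_gt0 muln_gt0 v_w w_u.
Qed.

Lemma incprod_src_onto m n (u : V m) : (m <= n)%N ->
  exists v : V n, (0 < incprod v u)%N.
Proof.
move/subnK <-; elim: (n - m)%N => [|k [w w_u]].
  by exists u; rewrite incprod_id eqxx.
have [e def_w] := src_onto w; exists (rng e).
apply: (@incprod_gt0_step _ _ _ w); rewrite ?leq_addl //.
by rewrite -def_w incidence_gt0.
Qed.

Lemma incprod_rng_onto m n (v : V n) : (m <= n)%N ->
  exists u : V m, (0 < incprod v u)%N.
Proof.
elim: n v => [|n IHn] v.
  by rewrite leqn0 => /eqP m0; subst m; exists v; rewrite incprod_id eqxx.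
rewrite leq_eqVlt => /orP[/eqP m_n|].
  by subst m; exists v; rewrite incprod_id eqxx.
rewrite ltnS => le_mn; have [e def_v] := rng_onto v.
have [u w_u] := IHn (src e) le_mn; exists u.
apply: (@incprod_gt0_step _ _ _ (src e)) => //.
by rewrite -def_v incidence_gt0.
Qed.

Section Telescoping.
Variables (t : nat -> nat) (t0 : t 0 = 0%N) (tS : forall i, (t i < t i.+1)%N).

Definition tele_vertex i : finType := V (t i).

Definition tele_edge i : finType :=
  {x : V (t i) * V (t i.+1) & 'I_(incprod x.2 x.1)}.

Definition tele_src i (e : tele_edge i) : tele_vertex i := (tag e).1.
Definition tele_rng i (e : tele_edge i) : tele_vertex i.+1 := (tag e).2.

Fact tele_top_single : #|tele_vertex 0| = 1%N.
Proof. by rewrite /tele_vertex t0 top_single. Qed.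

Fact tele_src_onto i (u : tele_vertex i) : exists e, @tele_src i e = u.
Proof.
have [v v_u] := incprod_src_onto u (ltnW (tS i)).
by exists (existT (fun x : V (t i) * V (t i.+1) => 'I_(incprod x.2 x.1))
  (u, v) (Ordinal v_u)).
Qed.

Fact tele_rng_onto i (v : tele_vertex i.+1) : exists e, @tele_rng i e = v.
Proof.
have [u v_u] := incprod_rng_onto v (ltnW (tS i)).
by exists (existT (fun x : V (t i) * V (t i.+1) => 'I_(incprod x.2 x.1))
  (u, v) (Ordinal v_u)).
Qed.

Definition telescoping : bratteli :=
  Bratteli tele_top_single tele_src_onto tele_rng_onto.

End Telescoping.

(* Finite paths (e_1, ..., e_n) from the top vertex, with their end vertex; for
   n = 0 this is the trivial path at the top vertex. *)
Fixpoint top_path_end n : {P : finType & P -> V n} :=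
  match n with
  | 0 => existT (fun P : finType => P -> V 0) (V 0) id
  | n'.+1 =>
      let: existT P pend := top_path_end n' in
      existT (fun Q : finType => Q -> V n'.+1)
        {pe : P * E n' | pend pe.1 == src pe.2} (fun q => rng (val q).2)
  end.

Definition top_path n : finType := projT1 (top_path_end n).
Definition path_end n : top_path n -> V n := projT2 (top_path_end n).

Definition npaths n (v : V n) : nat := #|[set p : top_path n | path_end p == v]|.

Definition max_paths n : nat := (\max_(v : V n) npaths v)%N.

(* Since V_n is non-empty, starting the iterated minimum from the maximum
   yields the true minimum. *)
Definition min_paths n : nat := \big[minn/max_paths n]_(v : V n) npaths v.

Definition infinite_path_space : Prop :=
  infinite_set [set e : forall i, E i | forall i, rng (e i) = src (e i.+1)]%classic.

(* The homomorphism Z^(V_m) -> Z^(V_n) of the inductive system, for m <= n. *)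
Definition push m n (x : {ffun V m -> int}) : {ffun V n -> int} :=
  [ffun v => \sum_(u : V m) (incprod v u)%:Z * x u].

Lemma push_id n (x : {ffun V n -> int}) : push n x = x.
Proof.
apply/ffunP => v; rewrite ffunE (bigD1 v) //= incprod_id eqxx mul1r.
by rewrite big1 ?addr0 // => u /negPf u_v; rewrite incprod_id eq_sym u_v mul0r.
Qed.

Lemma push_comp m n p (x : {ffun V m -> int}) : (m <= n)%N -> (n <= p)%N ->
  push p (push n x) = push p x.
Proof.
move=> le_mn le_np; apply/ffunP => v; rewrite !ffunE.
under eq_bigr do rewrite ffunE big_distrr.
rewrite exchange_big; apply: eq_bigr => u _ /=.
rewrite (incprod_comp _ _ le_mn le_np) -natz natr_sum big_distrl /=.
by apply: eq_bigr => w _; rewrite natz PoszM mulrA.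
Qed.

Lemma pushD m n : {morph @push m n : x y / x + y}.
Proof.
move=> x y; apply/ffunP => v; rewrite !ffunE -big_split /=.
by apply: eq_bigr => u _; rewrite ffunE mulrDr.
Qed.

Lemma pushN m n : {morph @push m n : x / - x}.
Proof.
move=> x; apply/ffunP => v; rewrite !ffunE -sumrN.
by apply: eq_bigr => u _; rewrite ffunE mulrN.
Qed.

Lemma push0 m n : push n (0 : {ffun V m -> int}) = 0.
Proof.
by apply/ffunP => v; rewrite !ffunE big1 // => u _; rewrite ffunE mulr0.
Qed.

Lemma push_ge0 m n (x : {ffun V m -> int}) : (forall u, 0 <= x u) ->
  forall v, 0 <= push n x v.
Proof. by move=> x0 v; rewrite ffunE sumr_ge0 // => u _; rewrite mulr_ge0. Qed.

(* The disjoint union of the groups of the inductive system. *)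
Definition levelvec : Type := {i : nat & {ffun V i -> int}}.
HB.instance Definition _ := Choice.on levelvec.

Definition levelv i (x : {ffun V i -> int}) : levelvec :=
  existT (fun i => {ffun V i -> int}) i x.

Definition lim_eq (x y : levelvec) : bool :=
  `[< exists n, [/\ (tag x <= n)%N, (tag y <= n)%N &
        push n (tagged x) = push n (tagged y)] >].

Fact lim_eq_refl : reflexive lim_eq.
Proof. by move=> x; apply/asboolP; exists (tag x). Qed.

Fact lim_eq_sym : symmetric lim_eq.
Proof.
by move=> x y; apply/asboolP/asboolP => -[n [? ? ?]]; exists n; split.
Qed.

Fact lim_eq_trans : transitive lim_eq.
Proof.
move=> y x z /asboolP[n [xn yn xy]] /asboolP[p [yp zp yz]].
apply/asboolP; exists (maxn n p).
split; rewrite ?(leq_trans xn) ?(leq_trans zp) ?leq_maxl ?leq_maxr //.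
rewrite -(push_comp _ xn) ?leq_maxl // xy push_comp ?leq_maxl //.
by rewrite -[RHS](push_comp _ zp) ?leq_maxr // -yz push_comp ?leq_maxr.
Qed.

Canonical lim_eq_equiv := EquivRel lim_eq lim_eq_refl lim_eq_sym lim_eq_trans.

Definition K0 : Type := {eq_quot lim_eq}%qT.
HB.instance Definition _ := Choice.on K0.
HB.instance Definition _ := EqQuotient.on K0.

Definition levelv_add (x y : levelvec) : levelvec :=
  let n := maxn (tag x) (tag y) in
  levelv (push n (tagged x) + push n (tagged y)).

Definition levelv_opp (x : levelvec) : levelvec := levelv (- tagged x).

Definition K0_class i (x : {ffun V i -> int}) : K0 := (\pi_K0 (levelv x))%qT.
Definition K0_zero : K0 := K0_class (0 : {ffun V 0 -> int}).
Definition K0_add (x y : K0) : K0 :=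
  (\pi_K0 (levelv_add (repr x) (repr y)))%qT.
Definition K0_opp (x : K0) : K0 := (\pi_K0 (levelv_opp (repr x)))%qT.

Lemma lim_eqP x y : reflect (x = y %[mod K0])%qT (lim_eq x y).
Proof. exact: eqquotP. Qed.

Lemma K0_classP i j (x : {ffun V i -> int}) (y : {ffun V j -> int}) :
  K0_class x = K0_class y <->
  exists n, [/\ (i <= n)%N, (j <= n)%N & push n x = push n y].
Proof.
split=> [/lim_eqP/asboolP //|xy]; by apply/lim_eqP/asboolP.
Qed.

Lemma K0_class_push i n (x : {ffun V i -> int}) : (i <= n)%N ->
  K0_class (push n x) = K0_class x.
Proof.
by move=> le_in; apply/K0_classP; exists n; rewrite push_id.
Qed.

Lemma K0_classE (x : K0) : exists i (a : {ffun V i -> int}), x = K0_class a.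
Proof.
exists (tag (repr x)), (tagged (repr x)).
by rewrite /K0_class -[LHS]reprK; case: (repr x).
Qed.

Lemma K0_class_ge (x : K0) : exists i, forall n, (i <= n)%N ->
  exists a : {ffun V n -> int}, x = K0_class a.
Proof.
have [i [a ->]] := K0_classE x; exists i => n le_in; exists (push n a).
by rewrite K0_class_push.
Qed.

Lemma levelv_addP (x y x' y' : levelvec) :
  lim_eq x x' -> lim_eq y y' -> lim_eq (levelv_add x y) (levelv_add x' y').
Proof.
case: x y x' y' => [i x] [j y] [i' x'] [j' y'] /asboolP[n /= [xn xn' xx']].
move=> /asboolP[p /= [yp yp' yy']]; apply/asboolP; exists (maxn n p).
have [le_n le_p] := (leq_maxl n p, leq_maxr n p).
have le_i := leq_trans xn le_n; have le_i' := leq_trans xn' le_n.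
have le_j := leq_trans yp le_p; have le_j' := leq_trans yp' le_p.
rewrite /= !geq_max le_i le_i' le_j le_j' !pushD.
split=> //.
rewrite !push_comp ?geq_max ?leq_maxl ?leq_maxr ?le_i ?le_j ?le_i' ?le_j' //.
congr (_ + _).
  by rewrite -(push_comp _ xn le_n) xx' push_comp.
by rewrite -(push_comp _ yp le_p) yy' push_comp.
Qed.

Lemma K0_addE n (a b : {ffun V n -> int}) :
  K0_add (K0_class a) (K0_class b) = K0_class (a + b).
Proof.
rewrite /K0_add /K0_class.
have -> : levelv (a + b) = levelv_add (levelv a) (levelv b).
  by rewrite /levelv_add /= maxnn !push_id.
by apply/lim_eqP/levelv_addP; apply/lim_eqP; rewrite reprK.
Qed.

Lemma K0_oppE n (a : {ffun V n -> int}) : K0_opp (K0_class a) = K0_class (- a).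
Proof.
rewrite /K0_opp /K0_class; apply/lim_eqP.
have /lim_eqP/asboolP[p /= [ap bp ab]] :
    (repr (K0_class a) = levelv a %[mod K0])%qT by rewrite reprK.
by apply/asboolP; exists p; split=> //=; rewrite !pushN ab.
Qed.

Lemma K0_zeroE n : K0_zero = K0_class (0 : {ffun V n -> int}).
Proof. by apply/K0_classP; exists n; split; rewrite // !push0. Qed.

Lemma K0_class3 (x y z : K0) : exists n (a b c : {ffun V n -> int}),
  [/\ x = K0_class a, y = K0_class b & z = K0_class c].
Proof.
have [[i xi] [j yj]] := (K0_class_ge x, K0_class_ge y).
have [k zk] := K0_class_ge z; pose n := maxn i (maxn j k).
have [|a xa] := xi n; first by rewrite leq_maxl.
have [|b yb] := yj n; first by rewrite leq_max leq_maxl orbT.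
have [|c zc] := zk n; first by rewrite leq_max leq_maxr orbT.
by exists n, a, b, c.
Qed.

Fact K0_addA : associative K0_add.
Proof.
move=> x y z; have [n [a [b [c [-> -> ->]]]]] := K0_class3 x y z.
by rewrite !K0_addE addrA.
Qed.

Fact K0_addC : commutative K0_add.
Proof.
move=> x y; have [n [a [b [_ [-> -> _]]]]] := K0_class3 x y y.
by rewrite !K0_addE addrC.
Qed.

Fact K0_add0 : left_id K0_zero K0_add.
Proof.
move=> x; have [n [a ->]] := K0_classE x.
by rewrite (K0_zeroE n) K0_addE add0r.
Qed.

Fact K0_addN : left_inverse K0_zero K0_opp K0_add.
Proof.
move=> x; have [n [a ->]] := K0_classE x.
by rewrite K0_oppE K0_addE addNr -K0_zeroE.
Qed.

HB.instance Definition _ :=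
  GRing.isZmodule.Build K0 K0_addA K0_addC K0_add0 K0_addN.

Definition K0_pos (x : K0) : Prop :=
  exists i (a : {ffun V i -> int}), (forall v, 0 <= a v) /\ x = K0_class a.

Definition K0_le (x y : K0) : bool := `[< K0_pos (y - x) >].

Fact K0_pos_ge x : K0_pos x -> exists i, forall n, (i <= n)%N ->
  exists a : {ffun V n -> int}, (forall v, 0 <= a v) /\ x = K0_class a.
Proof.
move=> [i [a [a0 ->]]]; exists i => n le_in; exists (push n a).
by rewrite K0_class_push //; split=> //; apply: push_ge0.
Qed.

Fact K0_le_refl : reflexive K0_le.
Proof.
move=> x; apply/asboolP; rewrite subrr; exists 0%N, 0.
by split=> // v; rewrite ffunE.
Qed.

Fact K0_le_anti : antisymmetric K0_le.
Proof.
move=> x y /andP[/asboolP/K0_pos_ge[i xi] /asboolP/K0_pos_ge[j yj]].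
have [a [a0 xa]] := xi _ (leq_maxl i j).
have [b [b0 yb]] := yj _ (leq_maxr i j).
have /K0_classP[n [_ le_n ab0]] :
    K0_class (a + b) = K0_class (0 : {ffun V (maxn i j) -> int}).
  rewrite -K0_addE -xa -yb -K0_zeroE -[LHS]/((y - x) + (x - y)).
  by rewrite addrA subrK subrr.
apply/esym/eqP; rewrite -subr_eq0 xa; apply/eqP.
rewrite -[RHS]/K0_zero (K0_zeroE n) -(K0_class_push _ le_n); congr K0_class.
apply/ffunP => v; have /ffunP/(_ v)/eqP := ab0.
rewrite push0 pushD [X in X == _]ffunE [X in _ == X]ffunE.
by rewrite paddr_eq0 ?push_ge0 // => /andP[/eqP-> _]; rewrite ffunE.
Qed.

Fact K0_le_trans : transitive K0_le.
Proof.
move=> y x z /asboolP/K0_pos_ge[i xi] /asboolP/K0_pos_ge[j yj].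
have [a [a0 xa]] := xi _ (leq_maxl i j).
have [b [b0 yb]] := yj _ (leq_maxr i j).
apply/asboolP; exists (maxn i j), (a + b).
split=> [v|]; first by rewrite ffunE addr_ge0.
by rewrite -K0_addE -xa -yb -[RHS]/((y - x) + (z - y)) [RHS]addrC addrA subrK.
Qed.

HB.instance Definition _ := Order.Le_isPOrder.Build ring_display K0
  K0_le_refl K0_le_anti K0_le_trans.

Definition K0_unit : K0 := K0_class ([ffun=> 1] : {ffun V 0 -> int}).

End Bratteli.

Definition simple_bratteli (B : bratteli) : Prop :=
  exists (t : nat -> nat) (t0 : t 0 = 0%N) (tS : forall i, (t i < t i.+1)%N),
    let T := telescoping B t0 tS in
    forall i (v : vertex T i.+1) (u : vertex T i), (0 < incidence v u)%N.

Definition K0_iso (B B' : bratteli) : Prop :=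
  exists phi : {additive K0 B -> K0 B'},
    [/\ bijective phi,
        {mono phi : x y / x <= y} &
        phi (K0_unit B) = K0_unit B'].

Definition pseudo_ERS (R : realType) (B : bratteli) : Prop :=
  simple_bratteli B /\
  ((fun i => (max_paths B i)%:R / (min_paths B i)%:R : R) @ \oo --> (1 : R))%classic.

Lemma npathsS (B : bratteli) n (v : vertex B n.+1) :
  npaths v = (\sum_(u : vertex B n) incidence v u * npaths u)%N.
Proof.
rewrite /npaths /path_end /top_path /=; case: (top_path_end B n) => P pend /=.
pose A := [set pe : P * edge B n | (pend pe.1 == src pe.2) && (rng pe.2 == v)].
set C := [set q | _]; have -> : #|C| = #|A|.
  rewrite -(card_imset _ val_inj); apply: eq_card => pe; rewrite inE.
  apply/imsetP/andP => [[q + ->]|[pe_ok pe_v]].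
    by rewrite inE => ->; rewrite (valP q).
  by exists (exist _ pe pe_ok : {pe | pend pe.1 == src pe.2}); rewrite ?inE.
rewrite -sum1_card (partition_big (fun pe => pend pe.1) xpredT) //=.
apply: eq_bigr => u _; rewrite mulnC /incidence -cardsX -sum1_card.
apply: eq_bigl => -[p e]; rewrite !inE /=.
by case: (pend p =P u) => [->|_]; rewrite ?andbF // andbT eq_sym.
Qed.

Lemma npaths_incprod (B : bratteli) n (v : vertex B n) (top : vertex B 0) :
  npaths v = incprod v top.
Proof.
elim: n v => [|n IHn] v; last first.
  by rewrite npathsS incprodS //; apply: eq_bigr => w _; rewrite IHn.
have Vtop (u w : vertex B 0) : u = w.
  by apply: fintype_le1P; rewrite top_single.
rewrite incprod_id (Vtop top v) eqxx /npaths; apply/eqP/cards1P; exists v.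
by apply/setP => u; rewrite !inE.
Qed.

Lemma incidence_telescoping (B : bratteli) t (t0 : t 0 = 0%N)
    (tS : forall i, (t i < t i.+1)%N) i
    (v : vertex (telescoping B t0 tS) i.+1)
    (u : vertex (telescoping B t0 tS) i) :
  incidence v u = @incprod B (t i) (t i.+1) v u.
Proof.
pose F (x : vertex B (t i) * vertex B (t i.+1)) := 'I_(incprod x.2 x.1).
rewrite /incidence -[RHS]card_ord -[RHS]cardsT.
rewrite -(card_imset _ (_ : injective (existT F (u, v)))) => [|k k']; last first.
  by move/eqP; rewrite eq_Tagged => /eqP.
apply: eq_card => -[[u' v'] k]; rewrite inE.
apply/andP/imsetP => [[/eqP u'_u /eqP v'_v]|[k' _ ek]].
  have {u'_u v'_v} [def_u def_v] : u = u' /\ v = v' by [].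
  by subst u v; exists k.
by have [eu ev] : (u', v') = (u, v) := congr1 tag ek; split; apply/eqP.
Qed.

(* Main.v *)
(** Insert between consecutive levels of (a telescoping of) B a level in which
    every vertex u of V_n is split into two: fix a weight q_u and give the two
    copies of u weights q_u and q_u + 1, so that they have q_u n_u and
    (q_u + 1) n_u paths from the top vertex, where n_u is the number of paths
    to u. The n_u being fixed, the q_u can be chosen arbitrarily large with
    q_u n_u = N independent of u; then all path counts of the new level lie in
    [N, N + max n_u], a window of bounded length, which is at most L h(L) for
    all L >= N as soon as N is large, because L h(L) tends to infinity.
    Every integer x > q(q + 1) is a combination of q and q + 1 with positive
    coefficients, and the entries of the incidence product from V_n to V_m tend
    to infinity with m, so for m large this product factors through the split
    vertices. The diagram of split vertices is thereby intertwined with B, and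
    hence has the same dimension group. *)
From HB Require Import structures.
Require Import Defs.
From mathcomp Require Import all_boot all_order all_algebra.
From mathcomp Require Import all_classical all_reals all_analysis.
From mathcomp Require Import zify.

Import Order.TTheory GRing.Theory Num.Theory.
Import numFieldNormedType.Exports.

Local Open Scope classical_set_scope.
Local Open Scope ring_scope.

Set Implicit Arguments.
Unset Strict Implicit.
Unset Printing Implicit Defensive.

(** * Growth of incidence products in a simple diagram with infinitely many paths *)

Section SimpleBratteli.
Variable B : bratteli.
Local Notation V := (vertex B).
Local Notation E := (edge B).

Lemma vertex_inhabited n : exists v : V n, True.
Proof.
have /fintype1[u _] := top_single B.
by have [v _] := incprod_src_onto u (leq0n n); exists v.
Qed.

Lemma incprod_lower m n p (v : V p) (w : V n) (u : V m) :
  (m <= n)%N -> (n <= p)%N -> (incprod v w * incprod w u <= incprod v u)%N.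
Proof.
by move=> mn np; rewrite (incprod_comp v u mn np) (bigD1 w) //= leq_addr.
Qed.

Lemma sum_incidence i :
  (\sum_(w : V i.+1) \sum_(u : V i) incidence w u)%N = #|E i|.
Proof.
rewrite pair_big /= -sum1_card.
rewrite (partition_big (fun e => (rng e, src e)) xpredT) //=.
apply: eq_bigr => -[w u] _ /=; rewrite /incidence -sum1_card.
by apply: eq_bigl => e; rewrite !inE xpair_eqE andbC.
Qed.

(* Inserting the level-n edges, the entry (v, u) is the sum over e in E_(n+1) of
   [incprod v (rng e) * incprod (src e) u]. *)
Lemma incprod_ge_edges m n p (v : V p) (u : V m) : (m <= n)%N -> (n < p)%N ->
  (forall w : V n.+1, 0 < incprod v w)%N -> (forall w : V n, 0 < incprod w u)%N ->
  (#|E n| <= incprod v u)%N.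
Proof.
move=> mn np vw wu; rewrite (incprod_comp v u (leqW mn) np) -sum_incidence.
apply: leq_sum => w _; rewrite (incprodS _ _ mn) big_distrr.
apply: leq_sum => w' _ /=; rewrite mulnCA.
by rewrite leq_pmulr // muln_gt0 vw wu.
Qed.

(** Between levels [t n] and [t n.+1] all entries are positive. This extends down to [n] and up to
    [p] because every vertex emits an edge and every vertex below the top receives one. *)
Lemma simple_incprod_gt0 n : simple_bratteli B ->
  exists2 p0, (n <= p0)%N & forall p, (p0 <= p)%N ->
    forall (v : V p) (u : V n), (0 < incprod v u)%N.
Proof.
move=> [t [t0 [tS tpos]]].
have n_t : (n <= t n)%N.
  by elim: n => [|n IHn] //; apply: leq_ltn_trans IHn (tS n).
exists (t n.+1) => [|p tp v u]; first exact: leq_trans n_t (ltnW (tS n)).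
have [w wu] := incprod_src_onto u n_t.
have [x vx] := incprod_rng_onto v tp.
have := tpos n x w; rewrite incidence_telescoping => xw.
have tt := ltnW (tS n).
apply: leq_trans (incprod_lower v x u (leq_trans n_t tt) tp).
rewrite muln_gt0 vx /=; apply: leq_trans (incprod_lower x w u n_t tt).
by rewrite muln_gt0 xw.
Qed.

(** From level [n0] on a path has no choice left, so its first [n0] edges determine it. *)
Lemma eventually_single_edge_finite_paths n0 :
  (forall n, (n0 <= n)%N -> (#|E n| <= 1)%N) -> ~ infinite_path_space B.
Proof.
move=> E1; apply.
pose F := {dffun forall i : 'I_n0, E i}.
pose g (e : forall i, E i) : F := [ffun i : 'I_n0 => e i].
have g_inj : injective g.
  move=> e e' ee'; apply: functional_extensionality_dep => i.
  have [lt_in|le_ni] := ltnP i n0.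
    by have /ffunP/(_ (Ordinal lt_in)) := ee'; rewrite !ffunE.
  by move/fintype_le1P: (E1 i le_ni); apply.
apply: (sub_finite_set (B := g @^-1` setT)) => //.
apply: finite_preimage; first by move=> x y _ _; apply: g_inj.
exact: finite_finset.
Qed.

(** Arbitrarily deep edge sets have at least two elements. Placed between two products with positive
    entries, such a set makes all entries at least 2; chaining [K] such blocks gives at least
    [2 ^ K]. *)
Lemma simple_incprod_large n K : simple_bratteli B -> infinite_path_space B ->
  exists2 p, (n < p)%N & forall (v : V p) (u : V n), (K <= incprod v u)%N.
Proof.
move=> sB infB.
have step m : exists2 p, (m < p)%N &
    forall (v : V p) (u : V m), (1 < incprod v u)%N.
  have [p0 m_p0 pos0] := simple_incprod_gt0 m sB.
  have [k p0_k Ek] : exists2 k, (p0 <= k)%N & (1 < #|E k|)%N.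
    apply: contrapT => noE.
    apply: (@eventually_single_edge_finite_paths p0 _ infB) => k p0_k.
    by rewrite leqNgt; apply/negP => Ek; apply: noE; exists k.
  have [p k_p posk] := simple_incprod_gt0 k.+1 sB.
  exists p => [|v u]; first by lia.
  by apply: leq_trans Ek (incprod_ge_edges _ _ _ _) => //;
    [lia|move=> w; apply: posk|move=> w; apply: pos0].
suff [p n_p pK] : exists2 p, (n < p)%N &
    forall (v : V p) (u : V n), (2 ^ K <= incprod v u)%N.
  by exists p => // v u; apply: leq_trans (pK v u); apply: ltnW (ltn_expl _ _).
elim: K => [|K [p n_p IH]].
  by have [p n_p p2] := step n; exists p => // v u; apply: ltnW (p2 v u).
have [q p_q q2] := step p; exists q => [|v u]; first exact: ltn_trans p_q.
have [w _] := vertex_inhabited p; rewrite expnS.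
apply: leq_trans (incprod_lower v w u (ltnW n_p) (ltnW p_q)).
exact: leq_mul.
Qed.

End SimpleBratteli.

(** * Criteria for simplicity and for an infinite path space *)

Lemma full_incidence_simple (B : bratteli) :
  (forall i (v : vertex B i.+1) (u : vertex B i), (0 < incidence v u)%N) ->
  simple_bratteli B.
Proof.
move=> B_gt0; exists id, erefl, (fun i => ltnSn i) => T i v u.
rewrite incidence_telescoping incprodS // (bigD1 u) //= incprod_id eqxx muln1.
by apply: leq_trans (B_gt0 i v u) (leq_addr _ _).
Qed.

Lemma branching_infinite_paths (B : bratteli) :
  (forall i (v : vertex B i.+1) (u : vertex B i), (1 < incidence v u)%N) ->
  infinite_path_space B.
Proof.
move=> B_gt1.
have br2 i (u : vertex B i) :
    exists e e' : edge B i, [/\ src e = u, src e' = u & e != e'].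
  have [v _] := vertex_inhabited B i.+1.
  have /card_gt1P[e [e' []]] := B_gt1 i v u; rewrite !inE.
  by move=> /andP[/eqP eu _] /andP[/eqP e'u _] ee'; exists e, e'.
pose e0 i u := projT1 (cid (br2 i u)).
pose e1 i u := projT1 (cid (projT2 (cid (br2 i u)))).
have eP i u : [/\ src (e0 i u) = u, src (e1 i u) = u & e0 i u != e1 i u].
  exact: projT2 (cid (projT2 (cid (br2 i u)))).
have [top _] := vertex_inhabited B 0.
(* The path of index [k] takes the default edge [e0] everywhere except at step [k]. If paths [k] and
   [l] coincided with [k != l], they would leave the same vertex at step [k] by [e1] and by [e0]. *)
pose next k i u := if i == k then e1 i u else e0 i u.
pose fix end_ k i : vertex B i :=
  if i is i'.+1 then rng (next k i' (end_ k i')) else top.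
pose path k i := next k i (end_ k i).
have srcE k i : src (path k i) = end_ k i.
  by rewrite /path /next; case: ifP => _; have [] := eP i (end_ k i).
have path_inj : injective path.
  move=> k l kl; apply: contrapT => /eqP k_l.
  have ends : end_ k k = end_ l k by rewrite -!srcE kl.
  have := congr1 (fun e => e k) kl; rewrite /path /next eqxx (negPf k_l) ends.
  by apply/eqP; rewrite eq_sym; have [] := eP k (end_ l k).
move=> fin; apply: infinite_nat.
have := finite_preimage (f := path) (in2W path_inj) fin.
apply: sub_finite_set => k _ /= i.
by rewrite srcE.
Qed.


(** * Diagrams with prescribed positive incidence matrices *)

Section MatrixDiagram.
Variables (W : nat -> finType) (A : forall i, W i.+1 -> W i -> nat).
Hypotheses (W0 : #|W 0| = 1%N) (W_gt0 : forall i, (0 < #|W i|)%N).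
Hypothesis A_gt0 : forall i (v : W i.+1) (u : W i), (0 < A v u)%N.

Definition mx_edge i : finType := {x : W i * W i.+1 & 'I_(A x.2 x.1)}.
Definition mx_src i (e : mx_edge i) : W i := (tag e).1.
Definition mx_rng i (e : mx_edge i) : W i.+1 := (tag e).2.
Definition mk_mx_edge i (u : W i) (v : W i.+1) (k : 'I_(A v u)) : mx_edge i :=
  existT (fun x : W i * W i.+1 => 'I_(A x.2 x.1)) (u, v) k.

Fact mx_src_onto i (u : W i) : exists e, @mx_src i e = u.
Proof.
by have /card_gt0P[v _] := W_gt0 i.+1; exists (mk_mx_edge (Ordinal (A_gt0 v u))).
Qed.

Fact mx_rng_onto i (v : W i.+1) : exists e, @mx_rng i e = v.
Proof.
by have /card_gt0P[u _] := W_gt0 i; exists (mk_mx_edge (Ordinal (A_gt0 v u))).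
Qed.

Definition mx_bratteli : bratteli := Bratteli W0 mx_src_onto mx_rng_onto.

Lemma incidence_mx i (v : W i.+1) (u : W i) :
  @incidence mx_bratteli i v u = A v u.
Proof.
rewrite /incidence -[RHS]card_ord -[RHS]cardsT.
rewrite -(card_imset _ (_ : injective (@mk_mx_edge i u v))) => [|k k']; last first.
  by move/eqP; rewrite eq_Tagged => /eqP.
apply: eq_card => -[[u' v'] k]; rewrite inE.
apply/andP/imsetP => [[/eqP u'_u /eqP v'_v]|[k' _ ek]].
  have {u'_u v'_v} [def_u def_v] : u' = u /\ v' = v by [].
  by subst u v; exists k.
by have [eu ev] : (u', v') = (u, v) := congr1 tag ek; split; apply/eqP.
Qed.

End MatrixDiagram.

(** * Actions of matrices of naturals, and maps out of a dimension group *)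

Definition mxact (T U : finType) (A : U -> T -> nat) (x : {ffun T -> int}) :
  {ffun U -> int} := [ffun u => \sum_t (A u t)%:Z * x t].

Section NatMatrixAction.
Variables T U W : finType.

Lemma mxactB (A : U -> T -> nat) : {morph mxact A : x y / x - y}.
Proof.
move=> x y; apply/ffunP => u; rewrite !ffunE -sumrB.
by apply: eq_bigr => t _; rewrite !ffunE mulrBr.
Qed.

Lemma mxact_ge0 (A : U -> T -> nat) (x : {ffun T -> int}) :
  (forall t, 0 <= x t) -> forall u, 0 <= mxact A x u.
Proof. by move=> x0 u; rewrite ffunE sumr_ge0 // => t _; rewrite mulr_ge0. Qed.

Lemma mxact_comp (A : U -> T -> nat) (C : W -> U -> nat) x :
  mxact C (mxact A x) = mxact (fun w t => (\sum_u C w u * A u t)%N) x.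
Proof.
apply/ffunP => w; rewrite !ffunE.
under eq_bigr do rewrite ffunE big_distrr.
rewrite exchange_big; apply: eq_bigr => t _ /=.
rewrite -natz natr_sum big_distrl /=.
by apply: eq_bigr => u _; rewrite natz PoszM mulrA.
Qed.

Lemma eq_mxact (A A' : U -> T -> nat) : (forall u t, A u t = A' u t) ->
  mxact A =1 mxact A'.
Proof.
by move=> AA' x; apply/ffunP => u; rewrite !ffunE; under eq_bigr do rewrite AA'.
Qed.

End NatMatrixAction.

Lemma push_mxact (B : bratteli) m n (x : {ffun vertex B m -> int}) :
  push n x = mxact (fun v u => incprod v u) x.
Proof. by []. Qed.

Lemma K0_leP (B : bratteli) (x y : K0 B) : x <= y <-> K0_pos (y - x).
Proof. by split=> /asboolP. Qed.

(** Universal property of the inductive limit, for bare functions: [phi] evaluates [g] at the chosen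
    representative, which agrees with any other one once both are pushed far enough. *)
Lemma K0_lift (B : bratteli) (S : Type)
    (g : forall n, {ffun vertex B n -> int} -> S) :
  (forall n (x : {ffun vertex B n -> int}), g n.+1 (push n.+1 x) = g n x) ->
  exists phi : K0 B -> S, forall n x, phi (@K0_class B n x) = g n x.
Proof.
move=> gS.
have g_push m n (x : {ffun vertex B m -> int}) : (m <= n)%N -> g n (push n x) = g m x.
  elim: n => [|n IHn]; first by rewrite leqn0 => /eqP m0; subst m; rewrite push_id.
  rewrite leq_eqVlt => /orP[/eqP m_n|le_mn]; first by subst m; rewrite push_id.
  by rewrite -(push_comp x le_mn (leqnSn n)) gS IHn.
exists (fun x => g _ (tagged (repr x))) => n x.
have /lim_eqP/asboolP[p /= [ap bp ab]] :
    (repr (K0_class x) = levelv x %[mod K0 B])%qT by rewrite reprK.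
by rewrite -(g_push _ _ _ ap) ab g_push.
Qed.

Lemma K0_zmod_morphism (B : bratteli) (G : zmodType) (phi : K0 B -> G) :
  (forall n (a b : {ffun vertex B n -> int}),
     phi (K0_class (a - b)) = phi (K0_class a) - phi (K0_class b)) ->
  zmod_morphism phi.
Proof.
move=> phiB x y; have [n [a [b [_ [-> -> _]]]]] := K0_class3 x y y.
by rewrite -phiB -K0_addE -K0_oppE.
Qed.

(** * Isomorphism of dimension groups from an intertwining of two diagrams *)

Section Intertwining.
Variables (B B' : bratteli) (m : nat -> nat).
Hypotheses (m_id : forall i, (i <= m i)%N) (m_incr : forall i, (m i <= m i.+1)%N).
Variable D : forall i, vertex B' i -> vertex B (m i) -> nat.
Variable C : forall i, vertex B (m i.+1) -> vertex B' i -> nat.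
Hypothesis CD : forall i (v : vertex B (m i.+1)) (u : vertex B (m i)),
  (\sum_w C v w * D w u)%N = incprod v u.
Hypothesis DC : forall i (v : vertex B' i.+1) (u : vertex B' i),
  (\sum_w D v w * C w u)%N = incidence v u.
(** The path counts at level [m 0] are the image of the order unit of [B], so [D] is required to
    send unit to unit. *)
Hypothesis D_unit : forall v : vertex B' 0, (\sum_u D v u * npaths u = 1)%N.

Let dn i := mxact (@D i).
Let up i := mxact (@C i).

Let up_dn i x : up (dn x) = push (m i.+1) x.
Proof. by rewrite /up /dn mxact_comp push_mxact; apply: eq_mxact => v u; rewrite CD. Qed.

Let dn_up i (y : {ffun vertex B' i -> int}) : dn (up y) = push i.+1 y.
Proof.
rewrite /up /dn mxact_comp push_mxact; apply: eq_mxact => v u; rewrite DC.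
by rewrite incprodS // (bigD1 u) //= incprod_id eqxx muln1 big1 ?addn0 //
  => w /negPf wu; rewrite incprod_id wu muln0.
Qed.

Let dnclass i n (x : {ffun vertex B n -> int}) := K0_class (dn (push (m i) x)).

Let dnclassS i n (x : {ffun vertex B n -> int}) : (n <= m i)%N ->
  dnclass i.+1 x = dnclass i x.
Proof.
move=> n_mi; rewrite /dnclass -(push_comp x n_mi (m_incr i)).
by rewrite -up_dn dn_up K0_class_push.
Qed.

Let dnclassE i j n (x : {ffun vertex B n -> int}) : (n <= m i)%N -> (i <= j)%N ->
  dnclass j x = dnclass i x.
Proof.
move=> n_mi /subnK <-; elim: (j - i)%N => [|k IHk] //.
rewrite addSn dnclassS // (leq_trans n_mi) //.
elim: k {IHk} => [|k IHk] //; exact: leq_trans IHk (m_incr _).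
Qed.

(** The two families of maps induce mutually inverse maps on the limits. Both come from matrices of
    naturals, hence both preserve positive cones, which gives the order equivalence in both
    directions. *)
Lemma K0_iso_intertwining : K0_iso B B'.
Proof.
(* Every [i] with [n <= m i] gives the same class; [i = n] is always admissible. *)
have [|phi phiE] := @K0_lift B _ (fun n x => dnclass n x).
  move=> n x; rewrite -(dnclassE x (m_id n) (leqnSn n)).
  by rewrite /dnclass push_comp ?m_id.
have phi_class i n (x : {ffun vertex B n -> int}) : (n <= m i)%N ->
    phi (K0_class x) = dnclass i x.
  move=> n_mi; rewrite phiE; have [n_i|i_n] := leqP n i.
    by rewrite (dnclassE x (m_id n) n_i).
  by rewrite (dnclassE x n_mi (ltnW i_n)).
have [|psi psiE] := @K0_lift B' _ (fun i y => K0_class (@up i y)).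
  by move=> i y; rewrite -dn_up up_dn K0_class_push.
have phiK : cancel phi psi.
  move=> x; have [n [a ->]] := K0_classE x.
  by rewrite phiE psiE up_dn !K0_class_push // (leq_trans (m_id n)).
have psiK : cancel psi phi.
  move=> y; have [i [b ->]] := K0_classE y.
  rewrite psiE (phi_class i.+1) // /dnclass push_id dn_up.
  by rewrite K0_class_push.
have phiB : zmod_morphism phi.
  apply: K0_zmod_morphism => n a b.
  by rewrite !phiE /dnclass /dn pushD pushN mxactB -K0_addE -K0_oppE.
have psiB : zmod_morphism psi.
  apply: K0_zmod_morphism => n a b.
  by rewrite !psiE /up mxactB -K0_addE -K0_oppE.
have phi_pos x : K0_pos x -> K0_pos (phi x).
  move=> [n [a [a0 ->]]]; rewrite phiE; exists n, (dn (push (m n) a)).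
  by split=> // v; apply: mxact_ge0 => u; apply: push_ge0.
have psi_pos y : K0_pos y -> K0_pos (psi y).
  move=> [n [b [b0 ->]]]; rewrite psiE; exists (m n.+1), (up b).
  by split=> // v; apply: mxact_ge0.
pose phiM := GRing.isZmodMorphism.Build _ _ phi phiB.
pose phi_add : {additive K0 B -> K0 B'} := HB.pack phi phiM.
exists phi_add; split; first by exists psi.
  move=> x y; apply/idP/idP => /K0_leP xy; apply/K0_leP.
    by have := psi_pos _ xy; rewrite psiB !phiK.
  by have := phi_pos _ xy; rewrite phiB.
rewrite [LHS]phiE /dnclass /K0_unit; congr K0_class.
apply/ffunP => v; rewrite !ffunE -[RHS]/((1%N)%:Z) -(D_unit v).
rewrite -[RHS]natz natr_sum; apply: eq_bigr => u _; rewrite natrM !natz.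
congr (_ * _); rewrite ffunE.
have [top _] := vertex_inhabited B 0.
rewrite (npaths_incprod u top) (bigD1 top) //= ffunE mulr1 big1 ?addr0 //.
move=> w; have /fintype_le1P/(_ w top)-> : (#|vertex B 0| <= 1)%N by rewrite top_single.
by rewrite eqxx.
Qed.

End Intertwining.

(** * Bounds on path counts *)

Section PathCounts.
Variable B : bratteli.

Lemma npaths_gt0 n (v : vertex B n) : (0 < npaths v)%N.
Proof. by have [u] := incprod_rng_onto v (leq0n n); rewrite (npaths_incprod v u). Qed.

Lemma npaths_comp m n (v : vertex B n) : (m <= n)%N ->
  npaths v = (\sum_(u : vertex B m) incprod v u * npaths u)%N.
Proof.
move=> mn; have [top _] := vertex_inhabited B 0.
rewrite (npaths_incprod v top) (incprod_comp v top (leq0n m) mn).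
by apply: eq_bigr => u _; rewrite (npaths_incprod u top).
Qed.

Lemma max_paths_leq n b : (forall v : vertex B n, npaths v <= b)%N ->
  (max_paths B n <= b)%N.
Proof. by move=> le_b; apply/bigmax_leqP. Qed.

Lemma max_paths_geq n a : (forall v : vertex B n, a <= npaths v)%N ->
  (a <= max_paths B n)%N.
Proof.
move=> a_le; have [v _] := vertex_inhabited B n.
exact: leq_trans (a_le v) (leq_bigmax v).
Qed.

Lemma min_paths_geq n a : (forall v : vertex B n, a <= npaths v)%N ->
  (a <= min_paths B n)%N.
Proof.
(* The iterated minimum starts from [max_paths], which must therefore be bounded below as well. *)
move=> a_le; apply: (big_ind (leq a)) => [|x y ax ay|//].
  exact: max_paths_geq.
by rewrite leq_min ax.
Qed.

Lemma min_le_max_paths n : (min_paths B n <= max_paths B n)%N.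
Proof.
by apply: (big_rec (fun x => x <= _)%N) => // v x _; rewrite geq_min orbC => ->.
Qed.

End PathCounts.

(** With two coins, write [x = y * q + s = (y - s) * q + s * q.+1], where [1 <= s <= q < y]. A
    single coin occurs only with value 1. *)
Lemma two_coins (b : bool) (q x : nat) : (0 < q)%N -> (~~ b -> q = 1%N) ->
  (q * q.+1 < x)%N ->
  exists c : 'I_b.+1 -> nat,
    (forall j, 0 < c j)%N /\ (\sum_j c j * (q + j))%N = x.
Proof.
move=> q_gt0 bq lt_x; case: b bq => bq.
  (* Dividing [x.-1] instead of [x] keeps the remainder [s] away from 0, so that both coefficients
     are positive. *)
  pose s := ((x.-1 %% q).+1)%N; pose y := (x.-1 %/ q)%N.
  have s_le : (s <= q)%N by rewrite /s ltn_mod.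
  have y_ge : (q < y)%N by rewrite /y leq_divRL // mulnC; lia.
  have x_eq : (x = y * q + s)%N by have := divn_eq x.-1 q; rewrite /s /y; lia.
  exists (fun j => if j == ord0 then y - s else s)%N; split=> [j|].
    by case: ifP; rewrite /s; lia.
  rewrite !big_ord_recl big_ord0 /= addn0; have -> : bump 0 0 = 1%N by [].
  nia.
exists (fun=> x); split=> [_|]; first by lia.
by rewrite big_ord1 bq // muln1.
Qed.

(** * The diagram of split vertices *)

Section Splitting.
Variables (B : bratteli) (q : forall n, vertex B n -> nat) (next : nat -> nat).
Hypothesis q_gt0 : forall n (v : vertex B n), (0 < q v)%N.
Hypothesis q0 : forall v : vertex B 0, q v = 1%N.
Hypothesis next_gt : forall n, (n < next n)%N.
Hypothesis next_large : forall n (v : vertex B (next n)) (u : vertex B n),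
  (q u * (q u).+1 < incprod v u)%N.

Definition level i : nat := iter i next 0%N.

Lemma level_id i : (i <= level i)%N.
Proof. by elim: i => // i IHi; apply: leq_ltn_trans IHi (next_gt _). Qed.

(* The top vertex is not split: ['I_(0 < level i).+1] has one element for i = 0
   and two otherwise. *)
Definition split_vertex i : finType :=
  (vertex B (level i) * 'I_(0 < level i)%N.+1)%type.

Definition split_weight i (x : split_vertex i) : nat := (q x.1 + x.2)%N.

Lemma split_coef_subproof i (v : vertex B (level i.+1)) (u : vertex B (level i)) :
  exists c : 'I_(0 < level i)%N.+1 -> nat,
    (forall j, 0 < c j)%N /\ (\sum_j c j * (q u + j))%N = incprod v u.
Proof.
apply: two_coins (q_gt0 u) _ (next_large v u).
by rewrite lt0n negbK; move: u; case: (level i) => // u _; apply: q0.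
Qed.

Definition split_coef i (v : vertex B (level i.+1)) (x : split_vertex i) : nat :=
  sval (cid (split_coef_subproof v x.1)) x.2.

Lemma split_coef_gt0 i (v : vertex B (level i.+1)) (x : split_vertex i) :
  (0 < split_coef v x)%N.
Proof. by have [c_gt0 _] := svalP (cid (split_coef_subproof v x.1)); apply: c_gt0. Qed.

Lemma sum_split_coef i (v : vertex B (level i.+1)) (u : vertex B (level i)) :
  (\sum_(j : 'I_(0 < level i)%N.+1)
    split_coef v (u, j) * split_weight (u, j))%N = incprod v u.
Proof. by have [_ csum] := svalP (cid (split_coef_subproof v u)). Qed.

(** This is the composite [D C] of the intertwining: from [y] to the vertex [x.1] of [B], then to
    its copy [x] with the weight of [x]. *)
Definition split_incidence i (x : split_vertex i.+1) (y : split_vertex i) : nat :=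
  (split_weight x * split_coef x.1 y)%N.

Fact card_split_vertex0 : #|split_vertex 0| = 1%N.
Proof. by rewrite card_prod card_ord top_single. Qed.

Fact card_split_vertex_gt0 i : (0 < #|split_vertex i|)%N.
Proof.
have [v _] := vertex_inhabited B (level i).
by apply/card_gt0P; exists (v, ord0).
Qed.

Fact split_incidence_gt0 i (x : split_vertex i.+1) (y : split_vertex i) :
  (0 < split_incidence x y)%N.
Proof. by rewrite muln_gt0 addn_gt0 q_gt0 split_coef_gt0. Qed.

Definition split_bratteli : bratteli :=
  mx_bratteli card_split_vertex0 card_split_vertex_gt0 split_incidence_gt0.

Lemma card_split_vertexS i :
  #|split_vertex i.+1| = (#|vertex B (level i.+1)| * 2)%N.
Proof.
by rewrite card_prod card_ord (leq_trans (ltn0Sn i) (level_id i.+1)).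
Qed.

Lemma split_incidence_ge i (x : vertex split_bratteli i.+1)
    (y : vertex split_bratteli i) : (q x.1 <= incidence x y)%N.
Proof.
rewrite incidence_mx; apply: leq_trans (leq_pmulr _ (split_coef_gt0 x.1 y)).
exact: leq_addr.
Qed.

(** By induction: summed over the copies of [u], coefficient times weight restores [incprod x.1 u],
    so the recursion for path counts in [B] reappears, multiplied by the weight of [x]. *)
Lemma npaths_split i (x : vertex split_bratteli i) :
  npaths x = (split_weight x * npaths x.1)%N.
Proof.
elim: i x => [|i IHi] x.
  rewrite (npaths_incprod x x) (npaths_incprod x.1 x.1) !incprod_id !eqxx.
  by rewrite /split_weight q0; case: x => u j; rewrite [j]ord1.
rewrite npathsS (npaths_comp x.1 (ltnW (next_gt (level i)))) big_distrr /=.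
under eq_bigr do rewrite IHi incidence_mx.
rewrite -(pair_bigA _ (fun u j => split_incidence x (u, j) *
   (split_weight (u, j) * npaths u))%N) /=.
apply: eq_bigr => u _; rewrite -(sum_split_coef x.1 u)
  big_distrl big_distrr /=.
by apply: eq_bigr => j _; rewrite /split_incidence !mulnA.
Qed.

Lemma K0_iso_split : K0_iso B split_bratteli.
Proof.
pose D i (x : vertex split_bratteli i) (v : vertex B (level i)) :=
  ((v == x.1) * split_weight x)%N.
have sumD i (x : vertex split_bratteli i) (F : vertex B (level i) -> nat) :
    (\sum_v D i x v * F v = split_weight x * F x.1)%N.
  rewrite (bigD1 x.1) //= /D eqxx mul1n big1 ?addn0 // => v /negPf->.
  by rewrite !mul0n.
apply: (@K0_iso_intertwining _ _ level level_id _ D split_coef).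
- by move=> i; apply: ltnW (next_gt _).
- move=> i v u; rewrite -(sum_split_coef v u) /D.
  rewrite -(pair_bigA _ (fun w j => split_coef v (w, j) *
    ((u == w) * split_weight (w, j)))%N) /= (bigD1 u) //= eqxx.
  rewrite [X in (_ + X)%N]big1 ?addn0.
    by apply: eq_bigr => j _; rewrite mul1n.
  by move=> w /negPf wu; rewrite big1 // => j _; rewrite eq_sym wu muln0.
- by move=> i x y; rewrite sumD incidence_mx.
move=> x; rewrite sumD; have := npaths_split x => <-.
by rewrite (npaths_incprod x x) incprod_id eqxx.
Qed.

End Splitting.

(** * Choice of the weights and limit arguments *)

Lemma balanced_weights (B : bratteli) n (a : nat) : exists (q : vertex B n -> nat) (N : nat),
  [/\ (a <= N)%N, (forall v, a < q v)%N & forall v, (q v * npaths v = N)%N].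
Proof.
(* Multiplying by [npaths v] completes the product over the level, which no longer depends on
   [v]. *)
exists (fun v => a.+1 * \prod_(w | w != v) npaths w)%N.
exists (a.+1 * \prod_(v : vertex B n) npaths v)%N.
have pos (P : pred (vertex B n)) : (0 < \prod_(w | P w) npaths w)%N.
  by apply: prodn_gt0 => w; apply: npaths_gt0.
split=> [|v|v]; first by apply: leq_trans (leqnSn a) (leq_pmulr _ (pos _)).
  by rewrite leq_pmulr.
by rewrite [in RHS](bigD1 v) //= -mulnA; congr (_ * _)%N; rewrite mulnC.
Qed.

Lemma mul_h_eventually_ge (R : realType) (h : nat -> R) (K : R) :
  (fun i => i%:R * h i) @ \oo --> +oo ->
  exists N, forall L, (N <= L)%N -> K <= L%:R * h L.
Proof.
move=> /cvgryPge/(_ K)[N _ NP]; exists N => L NL; exact: NP.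
Qed.

Lemma ratio_cvg1 (R : realType) (h : nat -> R) (l L : nat -> nat) :
  h @ \oo --> (0 : R) ->
  (forall i, (1 <= i)%N -> 1 - h i <= (l i)%:R / (L i)%:R) ->
  (forall i, (l i <= L i)%N) ->
  (fun i => (L i)%:R / (l i)%:R : R) @ \oo --> (1 : R).
Proof.
move=> h0 hlL lL.
have lL1 : (fun i => (l i)%:R / (L i)%:R : R) @ \oo --> (1 : R).
  apply: (@squeeze_cvgr _ _ _ _ (fun i => 1 - h i) (fun=> 1)).
  - near=> i; rewrite hlL /=; last by near: i; exists 1%N.
    (* If [L i = 0] the quotient is 0 by convention, still at most 1. *)
    have [L0|L0] := posnP (L i); first by rewrite L0 invr0 mulr0 ler01.
    by rewrite ler_pdivrMr ?ltr0n // mul1r ler_nat.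
  - by rewrite -[X in _ --> X]subr0; apply: cvgB => //; apply: cvg_cst.
  - exact: cvg_cst.
under eq_fun do rewrite -invf_div.
have := cvgV (oner_neq0 R) lL1; rewrite invr1; exact.
Unshelve. all: by end_near.
Qed.

Theorem theorem1p1 (R : realType) (B : bratteli)
    (simpleB : simple_bratteli B) (infB : infinite_path_space B)
    (h : nat -> R)
    (h_ge0 : forall i, (1 <= i)%N -> 0 <= h i)
    (h_decr : forall i j, (1 <= i)%N -> (i <= j)%N -> h j <= h i)
    (h_lim0 : h @ \oo --> (0 : R))
    (h_limoo : (fun i => i%:R * h i) @ \oo --> +oo)
    (f : nat -> R)
    (f_ge0 : forall i, (1 <= i)%N -> 0 <= f i)
    (f_incr : forall i j, (1 <= i)%N -> (i <= j)%N -> f i <= f j) :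
  exists B' : bratteli,
    [/\ simple_bratteli B' /\ infinite_path_space B',
        K0_iso B B',
        (forall i (u : vertex B' i) (v : vertex B' i.+1),
           f #|vertex B' i.+1| <= (incidence v u)%:R),
        (forall i, (1 <= i)%N ->
           1 - h (max_paths B' i) <=
           (min_paths B' i)%:R / (max_paths B' i)%:R) &
        pseudo_ERS R B'].
Proof.
have weights n : exists q : vertex B n -> nat,
    [/\ (forall v, 0 < q v)%N, (n = 0 -> forall v, q v = 1)%N &
      (0 < n)%N -> exists N,
      [/\ (n <= N)%N, forall L, (N <= L)%N -> (max_paths B n)%:R <= L%:R * h L,
          (forall v, q v * npaths v = N)%N, (forall v, 1 < q v)%N &
          (forall v, f (#|vertex B n| * 2) <= (q v)%:R)]].
  have [->|n_gt0] := posnP n; first by exists (fun=> 1%N).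
  have [N0 N0P] := mul_h_eventually_ge (max_paths B n)%:R h_limoo.
  pose F := Num.bound (f (#|vertex B n| * 2)%N).
  (* Each summand serves one requirement: [n] makes path counts unbounded, [N0] puts [N] in the
     range where [L * h L] is large, 1 forces weights above 1, and [F] dominates [f] at
     [2 * #|V_n|], the size of the split level. *)
  have [q [N [aN aq qN]]] := balanced_weights B n (n + N0 + 1 + F).
  exists q.
  split=> [v|n0|_]; [|by rewrite n0 in n_gt0|exists N; split=> // [|L NL|v|v]].
  - by have := aq v; lia.
  - lia.
  - by apply: N0P; lia.
  - by have := aq v; lia.
  apply: le_trans (ltW (archi_boundP (f_ge0 _ _))) _.
    have [w _] := vertex_inhabited B n.
    by rewrite muln_gt0 andbT; apply/card_gt0P; exists w.
  by rewrite ler_nat -/F; have := aq v; lia.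
have [q qP] := all_sig (fun n => cid (weights n)).
have q_gt0 n v : (0 < q n v)%N by have [] := qP n.
have q0 v : q 0 v = 1%N by have [_ /(_ erefl)] := qP 0%N.
have nexts n : exists p, (n < p)%N /\
    forall (v : vertex B p) (u : vertex B n), (q n u * (q n u).+1 < incprod v u)%N.
  pose K := (\max_u (q n u * (q n u).+1))%N.
  have [p n_p pP] := simple_incprod_large n K.+1 simpleB infB.
  exists p; split=> // v u; apply: leq_trans (pP v u); rewrite ltnS.
  exact: (leq_bigmax (F := fun u => (q n u * (q n u).+1)%N)).
have [next nextP] := choice nexts.
have next_gt n : (n < next n)%N by have [] := nextP n.
have next_large n (v : vertex B (next n)) (u : vertex B n) :
  (q n u * (q n u).+1 < incprod v u)%N by have [_] := nextP n; apply.
pose B' := split_bratteli q_gt0 q0 next_large.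
have npathsE i (v : vertex B' i) := npaths_split next_gt v.
have lvl_gt0 i : (0 < level next i.+1)%N.
  exact: leq_trans (ltn0Sn i) (level_id next_gt i.+1).
have inc_gt1 i (v : vertex B' i.+1) (u : vertex B' i) : (1 < incidence v u)%N.
  apply: leq_trans (split_incidence_ge v u).
  by have [_ _ /(_ (lvl_gt0 i))[N []]] := qP (level next i.+1).
have simpleB' : simple_bratteli B'.
  by apply: full_incidence_simple => i v u; apply: ltnW (inc_gt1 i v u).
have balanced i : (1 <= i)%N -> (i <= max_paths B' i)%N /\
    1 - h (max_paths B' i) <= (min_paths B' i)%:R / (max_paths B' i)%:R.
  case: i => // i _; set n := level next i.+1.
  have [_ _ /(_ (lvl_gt0 i))[N [nN hN qN _ _]]] := qP n.
  have geN (v : vertex B' i.+1) : (N <= npaths v)%N.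
    by rewrite npathsE -(qN v.1) leq_mul2r leq_addr orbT.
  (* The path count is [(q + j) * npaths v.1 = N + j * npaths v.1] with [j <= 1]. *)
  have leN (v : vertex B' i.+1) : (npaths v <= N + max_paths B n)%N.
    rewrite npathsE mulnDl qN leq_add2l.
    apply: leq_trans (leq_bigmax v.1); rewrite -[leqRHS]mul1n leq_mul2r.
    apply/orP; right; case: v => v [j /=]; rewrite ltnS => /leq_trans; apply.
    exact: leq_b1.
  have := max_paths_geq geN; have := min_paths_geq geN; have := max_paths_leq leN.
  set L := max_paths B' i.+1; set l := min_paths B' i.+1 => L_le N_l N_L.
  have i_L : (i < L)%N.
    exact: leq_trans (level_id next_gt i.+1) (leq_trans nN N_L).
  split=> //; have L_gt0 : 0 < L%:R :> R by rewrite ltr0n; lia.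
  rewrite ler_pdivlMr // mulrBl mul1r lerBlDr mulrC.
  have N_l' : N%:R <= l%:R :> R by rewrite ler_nat.
  (* It remains to see that [L <= N + max_paths B n], since [N <= l] and
     [max_paths B n <= L * h L]. *)
  apply: le_trans (lerD N_l' (hN L N_L)).
  by rewrite -natrD ler_nat.
exists B'; split.
- by split=> //; apply: branching_infinite_paths.
- exact: K0_iso_split.
- move=> i u v; rewrite card_split_vertexS //.
  have [_ _ /(_ (lvl_gt0 i))[N [_ _ _ _ fq]]] := qP (level next i.+1).
  by apply: le_trans (fq v.1) _; rewrite ler_nat; apply: split_incidence_ge.
- by move=> i /balanced[].
split=> //; apply: (ratio_cvg1 (h := h)) => // [i i_gt0|i].
  (* As the maximal path count is at least [i] and [h] decreases, [h i] may replace [h] at that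
     count. *)
  have [i_L] := balanced i i_gt0; apply: le_trans.
  by rewrite lerD2l lerN2 h_decr.
exact: min_le_max_paths.
Qed.
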